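(* Let $n\ge2$, let $X$ be a normed space with $d=\dim_{\mathbb R}X\geq 2$, and let $\mathcal G=(G,p,\theta,\tau)$ be a well-positioned and $\mathcal C_n$-symmetric bar-joint framework in $X$ with gain graph $(G_0,\psi)$. Suppose that $\mathcal T(X)$ is minimal and that $\mathcal G$ is $\chi_j$-symmetrically isostatic, where $j\in\{0,1,\dots,n-1\}$. If $j\neq0$, suppose also that $\theta$ acts freely on the edge set of $G$. (i) Suppose $n=2$. (a) If $j=0$ then $(G_0,\psi)$ is $(d,d,d-2)$-gain-tight. (b) If $j=1$ then $(G_0,\psi)$ is $(d,d,2)$-gain-tight. (ii) Suppose $n\ge3$. (a) If $j=0$ then $(G_0,\psi)$ is $(d,d,d-2)$-gain-tight. (b) If $j\in\{1,n-1\}$ then $(G_0,\psi)$ is $(d,d,1)$-gain-tight. (c) If $j\notin\{0,1,n-1\}$ then $(G_0,\psi)$ is $(d,d,0)$-gain-tight.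
   Context: $X$ is a finite dimensional real vector space with a norm $\|\cdot\|$; $\mathrm{Isom}(X)$ is its group of linear isometries; $X_{\mathbb C}=\mathbb C\otimes_{\mathbb R}X$. Here $\Gamma=\mathbb Z_n=\{\omega^k:k=0,\dots,n-1\}$, $\omega=e^{2\pi i/n}$, with characters $\chi_j(\omega)=\omega^j$. A real linear map and its complex-linear extension are denoted by the same symbol. A $\Gamma$-symmetric graph is $(G,\theta)$ with $G=(V,E)$ finite, simple, undirected and $\theta:\Gamma\to\mathrm{Aut}(G)$ a homomorphism acting freely on $V$; write $\gamma v$, $\gamma e$ for the action. A bar-joint framework in $X$ is $(G,p)$ with $p=(p_v)\in X^V$ having distinct components; it is well-positioned if $f_G:X^V\to\mathbb R^E$, $(x_v)\mapsto(\|x_v-x_w\|)_{vw\in E}$, is differentiable at $p$. A $\Gamma$-symmetric bar-joint framework is $\mathcal G=(G,p,\theta,\tau)$ where also $\tau:\Gamma\to\mathrm{Isom}(X)$ is a representation with $\tau(\gamma)p_v=p_{\gamma v}$. An $n$-fold rotation of a two-dimensional real space is a linear operator with matrix $\begin{pmatrix}\cos(2\pi/n)&-\sin(2\pi/n)\\ \sin(2\pi/n)&\cos(2\pi/n)\end{pmatrix}$ in some basis; if $\dim X\ge3$, an $n$-fold rotation of $X$ is an operator $S\oplus I_Z$ with respect to some decomposition $X=Y\oplus Z$, $\dim Y=2$, with $S$ an $n$-fold rotation of $Y$. A $\mathbb Z_n$-symmetric framework is $\mathcal C_n$-symmetric if $\tau(\omega)$ is an $n$-fold rotation of $X$. A rigid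 motion of $X$ is a family of continuous paths $\{\alpha_x:[-1,1]\to X\}_{x\in X}$ with $\alpha_x(0)=x$ and $\|\alpha_x(t)-\alpha_y(t)\|=\|x-y\|$ for all $x,y,t$. $\mathcal T(X)$ is the vector space of vector fields $\eta:X\to X$ of the form $\eta(x)=\alpha_x'(0)$ for a rigid motion $\{\alpha_x\}$. $\mathcal T(X)$ is minimal if every $\eta\in\mathcal T(X)$ is constant. $\mathcal T(X;\mathbb C)$ is the complex span of the fields $x\mapsto1\otimes\eta(x)\in X_{\mathbb C}$, $\eta\in\mathcal T(X)$. For a character $\chi$: $X_\chi=\{x\in(X_{\mathbb C})^V:x_{\gamma v}=\chi(\gamma)\tau(\gamma)x_v\ \forall\gamma,v\}$, $Y_\chi=\{y\in\mathbb C^E:y_{\gamma e}=\chi(\gamma)y_e\ \forall\gamma,e\}$, $\mathcal T_\chi(X)=\{\eta\in\mathcal T(X;\mathbb C):\eta(\tau(\gamma)x)=\chi(\gamma)\tau(\gamma)\eta(x)\ \forall\gamma,x\}$. $R_\chi(\mathcal G):X_\chi\to Y_\chi$ is the restriction of the complexified differential $df_G(p)$ and $\rho_\chi(\mathcal G):\mathcal T_\chi(X)\to X_\chi$, $\eta\mapsto(\eta(p_v))_v$. $\mathcal G$ is $\chi$-symmetrically isostatic if $\ker R_\chi(\mathcal G)=\mathrm{im}\,\rho_\chi(\mathcal G)$ and $R_\chi(\mathcal G)$ is surjective. Gain graph: $G_0=G/\Gamma$ is the quotient multigraph, with vertex set $V_0$ the vertex orbits $[v]$ and edge set $E_0$ the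 edge orbits $[e]$ ($[e]$ joins $[v]$ and $[w]$ if some edge in $[e]$ joins a vertex of $[v]$ to a vertex of $[w]$). Orient the edges of $G_0$ and choose a representative $\tilde v$ of each vertex orbit. The gain $\psi_{[e]}\in\Gamma$ of a directed edge $[e]=([v],[w])$ is the $\gamma\in\Gamma$ with $\tilde v(\gamma\tilde w)\in[e]$ (for a loop this is determined up to inversion, according to its orientation). $(G_0,\psi)$ is the gain graph of $(G,\theta)$; gain-tightness does not depend on the choices. The gain of a cycle is the product of the gains of its edges, inverted for edges traversed against their orientation; an edge set is balanced if it contains no cycle or every cycle in it has gain $1$ (loops and pairs of parallel edges count as cycles). For $0\le m\le l\le 2k-1$, $(G_0,\psi)$ is $(k,l,m)$-gain-sparse if $|F|\le k|V(F)|-l$ for every nonempty balanced $F\subseteq E(G_0)$ and $|F|\le k|V(F)|-m$ for every nonempty $F\subseteq E(G_0)$, where $V(F)$ is the set of vertices incident with $F$; it is $(k,l,m)$-gain-tight if in addition $|E(G_0)|=k|V(G_0)|-m$. *)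

(* Defs.v *)
From HB Require Import structures.
From mathcomp Require Import all_boot all_order all_algebra all_fingroup.
From mathcomp Require Import complex.
From mathcomp Require Import all_classical all_reals all_analysis.

Set Implicit Arguments.
Unset Strict Implicit.
Unset Printing Implicit Defensive.

Import Order.TTheory GRing.Theory Num.Theory.
Import numFieldNormedType.Exports.

Local Open Scope ring_scope.

#[short(type="normedVectType")]
HB.structure Definition NormedVector (R : numFieldType) :=
  { X of NormedModule R X & Vector R X }.

Section PowerNorm.
Variables (R : realType) (I : finType) (X : normedModType R).
Implicit Types x y : {ffun I -> X}.

Definition ffun_norm x : R := \big[Num.max/0]_i `|x i|.

Lemma ler_ffun_norm x i : `|x i| <= ffun_norm x.
Proof. exact: le_bigmax. Qed.

Lemma ffun_norm_le x (c : R) :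
  0 <= c -> (forall i, `|x i| <= c) -> ffun_norm x <= c.
Proof. by move=> c0 xc; apply/bigmax_leP; split. Qed.

Lemma ffun_norm_ge0 x : 0 <= ffun_norm x.
Proof. exact: bigmax_ge_id. Qed.

Lemma ffun_normD x y : ffun_norm (x + y) <= ffun_norm x + ffun_norm y.
Proof.
apply: ffun_norm_le => [|i]; first by rewrite addr_ge0 ?ffun_norm_ge0.
by rewrite ffunE (le_trans (ler_normD _ _))// lerD ?ler_ffun_norm.
Qed.

Lemma ffun_normZ (c : R) x : ffun_norm (c *: x) = `|c| * ffun_norm x.
Proof.
rewrite /ffun_norm (eq_bigr (fun i => `|c| * `|x i|)); last first.
  by move=> i _; rewrite ffunE normrZ.
by elim/big_ind2 : _ => [|a b u v -> ->|//]; rewrite ?mulr0 ?maxr_pMr.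
Qed.

Lemma ffun_norm_eq0 x : ffun_norm x = 0 -> x = 0.
Proof.
move=> x0; apply/ffunP => i; rewrite ffunE; apply/eqP.
by rewrite -normr_le0 -x0 ler_ffun_norm.
Qed.

(* X^I is normed by the maximum norm; in finite dimension the choice of norm
   affects neither differentiability nor the differential. *)
HB.instance Definition _ := Lmodule_isNormed.Build R {ffun I -> X}
  ffun_normD ffun_normZ ffun_norm_eq0.

End PowerNorm.

(* X_C = C (x)_R X, where (x, y) stands for 1 (x) x + i (x) y. *)
Definition complexification (R : realType) (X : lmodType R) : Type :=
  (X * X)%type.

Section Complexification.
Variables (R : realType) (X : lmodType R).
Implicit Types (z : complexification X) (c : R[i]).

HB.instance Definition _ := GRing.Zmodule.copy (complexification X) (X * X)%type.

Definition cscale c z : complexification X :=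
  (complex.Re c *: z.1 - complex.Im c *: z.2,
   complex.Re c *: z.2 + complex.Im c *: z.1).

Lemma cscaleA c c' z : cscale c (cscale c' z) = cscale (c * c') z.
Proof.
case: c c' z => [a b] [a' b'] [x y]; rewrite /cscale/=.
congr (_, _); rewrite !scalerBr !scalerDr !scalerBl !scalerDl !scalerA.
  by rewrite [b * a' *: y + _]addrC !opprD addrACA.
by rewrite [b * a' *: x - _]addrC addrACA.
Qed.

Lemma cscale1 : left_id 1 cscale.
Proof. by case=> x y; rewrite /cscale/= !scale1r !scale0r subr0 addr0. Qed.

Lemma cscaleDr : right_distributive cscale +%R.
Proof.
case=> [a b] [x y] [x' y']; rewrite /cscale/=.
by congr (_, _); rewrite !scalerDr ?opprD addrACA.
Qed.

Lemma cscaleDl z : {morph cscale^~ z : c c' / c + c'}.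
Proof.
move: z => [x y] [a b] [a' b']; rewrite /cscale/=.
by congr (_, _); rewrite !scalerDl ?opprD addrACA.
Qed.

HB.instance Definition _ := GRing.Zmodule_isLmodule.Build R[i]
  (complexification X) cscaleA cscale1 cscaleDr cscaleDl.

Definition oneC (x : X) : complexification X := (x, 0).

Definition extC (f : X -> X) z : complexification X := (f z.1, f z.2).

End Complexification.

Record sgraph := SGraph {
  vertex : finType;
  edges : {set {set vertex}};
  edges_card2 : forall e, e \in edges -> #|e| = 2%N;
  vertex_nonempty : (0 < #|vertex|)%N }.

Definition edge (G : sgraph) : finType := {e : {set vertex G} | e \in edges G}.

Record symgraph (gT : finGroupType) := SymGraph {
  graph_of :> sgraph;
  theta : gT -> {perm vertex graph_of};
  thetaM : forall g h v, theta (g * h)%g v = theta g (theta h v);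
  theta_edges : forall g (e : {set vertex graph_of}),
    (theta g @: e \in edges graph_of) = (e \in edges graph_of);
  theta_free : forall g v, theta g v = v -> g = 1%g }.

Section SymGraphTheory.
Variables (gT : finGroupType) (G : symgraph gT).

Lemma edge_act_subproof (g : gT) (e : edge G) : theta G g @: val e \in edges G.
Proof. by rewrite theta_edges (valP e). Qed.

Definition edge_act (g : gT) (e : edge G) : edge G :=
  Sub (theta G g @: val e) (edge_act_subproof g e).

Definition edge_free := forall (g : gT) (e : edge G), edge_act g e = e -> g = 1%g.

Definition vertex_orbits : {set {set vertex G}} :=
  [set [set theta G g v | g : gT] | v : vertex G].

Definition edge_orbits : {set {set {set vertex G}}} :=
  [set [set theta G g @: e | g : gT] | e : {set vertex G} in edges G].

Definition qvertex : finType := {A : {set vertex G} | A \in vertex_orbits}.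
Definition qedge : finType := {A : {set {set vertex G}} | A \in edge_orbits}.

End SymGraphTheory.

(* Directed multigraph (loops and parallel edges allowed) with gains. *)
Record gain_graph (gT : finGroupType) := GainGraph {
  gvertex : finType;
  gedge : finType;
  gsrc : gedge -> gvertex;
  gtgt : gedge -> gvertex;
  gain : gedge -> gT }.

(* A choice of orbit representatives, of an orientation of the quotient
   multigraph, and of the resulting gains.  The condition [gc_gainP] says at
   once that [e] joins [gc_src e] to [gc_tgt e] and that [gc_gain e] is its
   gain; on a loop it leaves the choice between a gain and its inverse. *)
Record gain_choice (gT : finGroupType) (G : symgraph gT) := GainChoice {
  gc_rep : qvertex G -> vertex G;
  gc_repP : forall a, gc_rep a \in val a;
  gc_src : qedge G -> qvertex G;
  gc_tgt : qedge G -> qvertex G;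
  gc_gain : qedge G -> gT;
  gc_gainP : forall e,
    [set gc_rep (gc_src e); theta G (gc_gain e) (gc_rep (gc_tgt e))] \in val e }.

Definition gain_graph_of (gT : finGroupType) (G : symgraph gT)
    (c : gain_choice G) : gain_graph gT :=
  GainGraph (gc_src c) (gc_tgt c) (gc_gain c).

Section GainSparsity.
Variables (gT : finGroupType) (H : gain_graph gT).
Implicit Types (F : {set gedge H}) (k l m : nat).

(* An edge with a direction of traversal; [true] is against the orientation. *)
Definition dart : Type := (gedge H * bool)%type.
Definition dsrc (a : dart) := if a.2 then gtgt a.1 else gsrc a.1.
Definition dtgt (a : dart) := if a.2 then gsrc a.1 else gtgt a.1.
Definition dgain (a : dart) : gT := if a.2 then (gain a.1)^-1%g else gain a.1.

(* [path.cycle] makes the darts of [c] consecutive, cyclically. *)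
Definition is_cycle (c : seq dart) : bool :=
  [&& c != [::], path.cycle (fun a b => dtgt a == dsrc b) c,
      uniq [seq dsrc a | a <- c] & uniq [seq a.1 | a <- c]].

Definition cycle_gain (c : seq dart) : gT := (\prod_(a <- c) dgain a)%g.

Definition balanced F : Prop := forall c : seq dart,
  is_cycle c -> {subset [seq a.1 | a <- c] <= F} -> cycle_gain c = 1%g.

Definition vsupport F : {set gvertex H} :=
  [set v | [exists e in F, (v == gsrc e) || (v == gtgt e)]].

(* The bounds |F| <= k|V(F)| - l are written without (truncated) subtraction. *)
Definition gain_sparse k l m : Prop :=
  [/\ (m <= l <= 2 * k - 1)%N,
      forall F, F != finset.set0 -> balanced F -> (#|F| + l <= k * #|vsupport F|)%N
    & forall F, F != finset.set0 -> (#|F| + m <= k * #|vsupport F|)%N].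

Definition gain_tight k l m : Prop :=
  gain_sparse k l m /\ (#|gedge H| + m = k * #|gvertex H|)%N.

End GainSparsity.

Section Rotation.
Variables (R : realType) (X : vectType R).

(* [S] maps [Y] to itself and acts on it, in some basis (b1, b2), through the
   rotation matrix of angle 2 pi / n, whose columns are the images of b1, b2. *)
Definition rotation_on (n : nat) (Y : {vspace X}) (S : X -> X) : Prop :=
  let t : R := 2 * pi / n%:R in
  exists b1 b2 : X, [/\ basis_of Y [:: b1; b2],
    S b1 = cos t *: b1 + sin t *: b2 &
    S b2 = - sin t *: b1 + cos t *: b2].

Definition nfold_rotation (n : nat) (S : X -> X) : Prop :=
  (\dim {:X} = 2%N /\ rotation_on n {:X} S) \/
  ((3 <= \dim {:X})%N /\
   exists Y Z : {vspace X}, [/\ (Y + Z)%VS = {:X}%VS, (Y :&: Z)%VS = 0%VS,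
     \dim Y = 2%N, rotation_on n Y S & forall z, z \in Z -> S z = z]).

End Rotation.

Section RigidMotions.
Local Open Scope classical_set_scope.
Variables (R : realType) (X : normedModType R).

Definition rigid_motion (alpha : X -> R -> X) : Prop :=
  [/\ forall x, {within `[-1, 1], continuous (alpha x)},
      forall x, alpha x 0 = x
    & forall x y (t : R), t \in `[-1, 1] ->
        `|alpha x t - alpha y t| = `|x - y| ].

Definition inf_motions : set (X -> X) :=
  [set eta | exists2 alpha, rigid_motion alpha &
     forall x, is_derive (0 : R^o) 1 (alpha x : R^o -> X) (eta x)].

Definition inf_motions_minimal : Prop :=
  forall eta, inf_motions eta -> exists a, forall x, eta x = a.

Definition inf_motionsC : set (X -> complexification X) :=
  [set eta | exists (k : nat) (c : 'I_k -> R[i]) (h : 'I_k -> X -> X),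
     (forall i, inf_motions (h i)) /\
     forall x, eta x = \sum_(i < k) c i *: oneC (h i x)].

End RigidMotions.

Record sym_framework (R : realType) (X : normedModType R) (gT : finGroupType) :=
  SymFramework {
    sgraph_of :> symgraph gT;
    pos : {ffun vertex sgraph_of -> X};
    pos_inj : injective pos;
    tau : gT -> {linear X -> X};
    tau_isom : forall g x, `|tau g x| = `|x|;
    tau1 : forall x, tau 1%g x = x;
    tauM : forall g h x, tau (g * h)%g x = tau g (tau h x);
    tau_pos : forall g v, tau g (pos v) = pos (theta sgraph_of g v) }.

Section RigidityMap.
Variables (R : realType) (X : normedModType R) (G : sgraph).

(* f_G.  The pair of endpoints always exists and `|x v - x w| does not depend
   on its order, see [rigidity_mapE]. *)
Definition rigidity_map (x : {ffun vertex G -> X}) : {ffun edge G -> R^o} :=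
  [ffun e : edge G =>
     (if [pick u : vertex G * vertex G | val e == [set u.1; u.2]] is Some u
      then `|x u.1 - x u.2| else 0) : R^o].

Lemma rigidity_mapE x (e : edge G) v w :
  val e = [set v; w] -> rigidity_map x e = `|x v - x w|.
Proof.
move=> evw; rewrite ffunE; case: pickP => [[a b]/= /eqP|/(_ (v, w))]; last first.
  by rewrite /= evw eqxx.
rewrite evw => vwab; have := edges_card2 (valP e); rewrite evw cards2.
have [//|vw _] := eqVneq v w.
have: v \in [set a; b] by rewrite -vwab !inE eqxx.
have: w \in [set a; b] by rewrite -vwab !inE eqxx orbT.
rewrite !inE => /orP[]/eqP wE /orP[]/eqP vE; rewrite wE vE ?eqxx// in vw *.
by rewrite distrC.
Qed.

End RigidityMap.

Section SymmetricRigidity.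
Local Open Scope classical_set_scope.
Variables (R : realType) (X : normedModType R) (gT : finGroupType).
Variables (S : sym_framework X gT) (chi : gT -> R[i]).

Definition well_positioned : Prop :=
  differentiable (@rigidity_map R X S) (pos S).

Definition rigidity_operator (x : {ffun vertex S -> X}) : {ffun edge S -> R^o} :=
  'd (@rigidity_map R X S) (pos S) x.

Definition rigidity_operatorC (z : {ffun vertex S -> complexification X}) :
    {ffun edge S -> R[i]} :=
  [ffun e => Complex (rigidity_operator [ffun v => (z v).1] e)
                     (rigidity_operator [ffun v => (z v).2] e)].

Definition X_chi : set {ffun vertex S -> complexification X} :=
  [set z | forall g v, z (theta S g v) = chi g *: extC (tau S g) (z v)].

Definition Y_chi : set {ffun edge S -> R[i]} :=
  [set y | forall g e, y (edge_act g e) = chi g * y e].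

Definition T_chi : set (X -> complexification X) :=
  [set eta | inf_motionsC eta /\
     forall g x, eta (tau S g x) = chi g *: extC (tau S g) (eta x)].

Definition rho_chi (eta : X -> complexification X) :
    {ffun vertex S -> complexification X} := [ffun v => eta (pos S v)].

Definition sym_isostatic : Prop :=
  [set z | X_chi z /\ rigidity_operatorC z = 0] = rho_chi @` T_chi
  /\ forall y, Y_chi y ->
       exists2 z, X_chi z & rigidity_operatorC z = y.

End SymmetricRigidity.

(* The group {omega^k} of n-th roots of unity is represented, for n >= 2, by
   the exponents k in 'Z_n, whose group law is addition modulo n; the generator
   omega is 1 : 'Z_n. *)
Section CyclicGroup.
Variables (R : realType) (n : nat).

Definition omega : R[i] :=
  Complex (cos (2 * pi / n%:R)) (sin (2 * pi / n%:R)).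

Definition chi (j : nat) (k : 'Z_n) : R[i] := omega ^+ (j * k).

Definition Cn_symmetric (X : normedVectType R) (S : sym_framework X 'Z_n) : Prop :=
  nfold_rotation n (tau S (1 : 'Z_n)%R).

End CyclicGroup.

(* Main.v *)
Require Import Defs.
From HB Require Import structures.
From mathcomp Require Import all_boot all_order all_algebra all_fingroup.
From mathcomp Require Import complex.
From mathcomp Require Import lra.
From mathcomp Require Import all_classical all_reals all_analysis.

(* Complexify and choose a basis of X_C of eigenvectors of tau(omega): the
   eigenvalues are omega, omega^-1 and, d - 2 times, 1.  In these coordinates
   chi_j(g) tau(g) acts on the i-th axis by a character mu_i, and X_chi becomes the
   space of functions on V_0 x {1..d}.  Surjectivity of R_chi says that the rows
   indexed by E_0 are independent, so any set F of edge orbits satisfies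
   |F| <= d |V(F)| - dim K for every space K of vectors supported on V(F) killed by
   the rows of F.  Minimality makes T_chi the space of invariant constants, whose
   dimension m is the number of i with mu_i = 1; it serves as K for every F and is
   the whole kernel when F = E_0.  If F is balanced its gains come from a potential
   p, gain(e) = p(src e) p(tgt e)^-1, and the twisted constants v |-> mu_i(p v) a_i
   provide a K of dimension d.  Only two facts about the norm enter:
   the row of an edge kills the vectors that agree at both of its ends, and the
   rows are equivariant under the isometries tau(g). *)

Import Order.TTheory GRing.Theory Num.Theory.
Import numFieldNormedType.Exports.
Set Implicit Arguments.
Unset Strict Implicit.
Unset Printing Implicit Defensive.
Local Open Scope ring_scope.

(** * Independent rows and the sparsity count *)

Section DimensionCount.
Variable F : fieldType.

Lemma dim_ffun_regular (I : finType) : \dim {:{ffun I -> F^o}} = #|I|.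
Proof. by rewrite dimvf /dim /= muln1. Qed.

(** Rank-nullity for [f]: the image of [k] lies in the kernel of [f] and has the dimension of
    [U]. *)
Lemma dim_surjective (U V W : vectType F) (f : {linear V -> W})
    (k : {linear U -> V}) :
  (forall w, exists v, f v = w) -> (forall u, k u = 0 -> u = 0) ->
  (forall u, f (k u) = 0) -> (\dim {:W} + \dim {:U} <= \dim {:V})%N.
Proof.
move=> fsurj kinj fk0.
have kerk : lker (linfun k) = 0%VS.
  apply/eqP; rewrite -subv0; apply/subvP => u.
  by rewrite memv_ker memv0 lfunE => /eqP/kinj ->.
have imf : limg (linfun f) = fullv.
  apply/eqP; rewrite eqEsubv subvf /=; apply/subvP => w _.
  by have [v <-] := fsurj w; rewrite -(lfunE f) memv_img ?memvf.
rewrite -(limg_ker_dim (linfun f) fullv) imf capfv addnC leq_add2r.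
rewrite -(@limg_dim_eq _ _ _ (linfun k) fullv) ?kerk ?capv0//.
apply: dimvS; apply/subvP => v /memv_imgP[u _ ->].
by rewrite memv_ker !lfunE/= fk0.
Qed.

(** Exactness at [V] turns the previous inequality into the dimension formula of a short exact
    sequence. *)
Lemma dim_surjective_eq (U V W : vectType F) (f : {linear V -> W})
    (k : {linear U -> V}) :
  (forall w, exists v, f v = w) -> (forall u, k u = 0 -> u = 0) ->
  (forall u, f (k u) = 0) -> (forall v, f v = 0 -> exists u, v = k u) ->
  (\dim {:W} + \dim {:U} = \dim {:V})%N.
Proof.
move=> fsurj kinj fk0 fker; apply/eqP.
rewrite eqn_leq (dim_surjective (f := f) (k := k))//=.
rewrite -(limg_ker_dim (linfun f) fullv) capfv addnC leq_add ?dimvS ?subvf//.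
apply: (@leq_trans (\dim (limg (linfun k)))); last first.
  by rewrite -(limg_ker_dim (linfun k) fullv) leq_addl.
apply: dimvS; apply/subvP => v; rewrite memv_ker lfunE => /eqP/fker[u ->].
by rewrite -(lfunE k) memv_img ?memvf.
Qed.

Section Incidence.
Variables (V0 E0 K J : finType).
Variables (f : {linear {ffun V0 * K -> F^o} -> {ffun E0 -> F^o}}).
Variables (src tgt : E0 -> V0).
Hypothesis fsurj : forall y, exists w, f w = y.
Hypothesis floc : forall (w : {ffun V0 * K -> F^o}) e,
  (forall i, w (src e, i) = 0) -> (forall i, w (tgt e, i) = 0) -> f w e = 0.

(** Rows in [A] have their support over [VA], so they stay independent after the columns outside
    [VA] are deleted. Injectivity of [k] is asked at each single vertex: since [A] is nonempty, [VA]
    contains one, and restricting [k] to [VA] loses nothing. *)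
Lemma incidence_count (A : {set E0})
    (k : {linear {ffun J -> F^o} -> {ffun V0 * K -> F^o}})
    (VA := [set v | [exists e in A, (v == src e) || (v == tgt e)]]) :
  A != finset.set0 ->
  (forall u v, (forall i, k u (v, i) = 0) -> u = 0) ->
  (forall u e, e \in A -> f (k u) e = 0) ->
  (#|A| + #|J| <= #|VA| * #|K|)%N.
Proof.
move=> A0 kinj fk0.
pose ext (w : {ffun {v | v \in VA} * K -> F^o}) : {ffun V0 * K -> F^o} :=
  [ffun x => if insub x.1 is Some v then w (v, x.2) else 0].
pose g w : {ffun {e | e \in A} -> F^o} := [ffun e => f (ext w) (val e)].
have extP : linear ext.
  move=> a u v; apply/ffunP => -[x i]; rewrite !ffunE/=.
  by case: insubP => [y _ _|_]; rewrite ?ffunE// scaler0 addr0.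
have gP : linear g.
  by move=> a u v; apply/ffunP => e; rewrite !ffunE extP linearP !ffunE.
pose h (u : {ffun J -> F^o}) : {ffun {v | v \in VA} * K -> F^o} :=
  [ffun x => k u (val x.1, x.2)].
have hP : linear h.
  by move=> a u v; apply/ffunP => e; rewrite !ffunE linearP !ffunE.
(* Restriction to [VA] followed by extension by zero alters [w] only off [VA], where by [floc] the
   rows of [A] see nothing. *)
have fext (w : {ffun V0 * K -> F^o}) e : e \in A ->
    f (ext [ffun x => w (val x.1, x.2)]) e = f w e.
  move=> eA; apply/eqP; rewrite -subr_eq0.
  have -> : f (ext [ffun x => w (val x.1, x.2)]) e - f w e =
            f (ext [ffun x => w (val x.1, x.2)] - w) e.
    by rewrite linearB !ffunE.
  rewrite floc// => i; rewrite !ffunE/=; case: insubP => [y _ yE|].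
  - by rewrite ffunE/= yE subrr.
  - by rewrite inE => /existsP[]; exists e; rewrite eA eqxx.
  - by rewrite ffunE/= yE subrr.
  - by rewrite inE => /existsP[]; exists e; rewrite eA eqxx orbT.
pose gl := HB.pack_for {linear {ffun {v | v \in VA} * K -> F^o} ->
  {ffun {e | e \in A} -> F^o}} g (GRing.isLinear.Build _ _ _ _ _ gP).
pose hl := HB.pack_for {linear {ffun J -> F^o} ->
  {ffun {v | v \in VA} * K -> F^o}} h (GRing.isLinear.Build _ _ _ _ _ hP).
have := @dim_surjective _ _ _ gl hl.
rewrite !dim_ffun_regular card_prod !card_sig; apply.
- move=> y; have [w wy] := fsurj [ffun e => if insub e is Some e then y e else 0].
  exists [ffun x => w (val x.1, x.2)]; apply/ffunP => e.
  by rewrite /gl/= ffunE fext ?(valP e)// wy ffunE valK.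
- move=> u /ffunP hu0; have /set0Pn[e eA] := A0.
  apply: (kinj _ (src e)) => i.
  have eV : src e \in VA by rewrite inE; apply/existsP; exists e; rewrite eA eqxx.
  by have := hu0 (Sub (src e) eV, i); rewrite !ffunE.
- by move=> u; apply/ffunP => e; rewrite /gl/hl/= !ffunE fext ?(valP e)// fk0 ?(valP e).
Qed.

End Incidence.
End DimensionCount.

(** * Potentials of balanced edge sets *)

Section Potential.
Variables (gT : finGroupType) (H : gain_graph gT).
Implicit Types (A : {set gedge H}) (g : gedge H -> gT).

Definition potential A (f : gvertex H -> gT) : Prop :=
  forall e, e \in A -> gain e = (f (gsrc e) * (f (gtgt e))^-1)%g.

Definition linked A : rel (gvertex H) :=
  fun u v => [exists a : dart H, [&& a.1 \in A, dsrc a == u & dtgt a == v]].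

Lemma linked_sym A : symmetric (linked A).
Proof.
suff H1 u v : linked A u v -> linked A v u by move=> u v; apply/idP/idP => /H1.
move=> /existsP[[e b]] /and3P[/= eA /eqP<- /eqP<-].
by apply/existsP; exists (e, ~~ b); rewrite eA; case: b; rewrite /dsrc/dtgt/= !eqxx.
Qed.

(** A walk without repeated vertices cannot repeat an edge either, which [is_cycle] requires
    separately. *)
Lemma dart_walk A u p : path (linked A) u p -> uniq (u :: p) ->
  exists c : seq (dart H),
    [/\ [seq dsrc a | a <- c] = belast u p, [seq dtgt a | a <- c] = p,
        {subset [seq a.1 | a <- c] <= A} & uniq [seq a.1 | a <- c]].
Proof.
elim: p u => [|v p IHp] u /=; first by exists [::]; split.
move=> /andP[/existsP[a /and3P[aA /eqP au /eqP av]] vp] /andP[up uvp].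
have [c [cs ct cA cu]] := IHp v vp uvp.
exists (a :: c); split => /=.
- by rewrite au cs.
- by rewrite av ct.
- by move=> e; rewrite inE => /orP[/eqP->//|/cA].
(* A later dart on the same edge would have [u] as an end, but the ends of later darts lie in
   [v :: p]. *)
rewrite cu andbT; apply/mapP => -[b bc abE].
have bs : dsrc b \in v :: p.
  by apply: mem_belast; rewrite -cs; apply: map_f.
have bt : dtgt b \in v :: p by rewrite inE -ct map_f ?orbT.
have : (dsrc a == dsrc b) || (dsrc a == dtgt b).
  rewrite /dsrc /dtgt abE; case: (a.2) (b.2) => -[]; by rewrite eqxx ?orbT.
by rewrite au => /orP[]/eqP uE; move: up; rewrite uE ?bs ?bt.
Qed.

(** The product telescopes; reversing a dart inverts both its gain and the quotient of
    potentials. *)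
Lemma potential_walk A f (c : seq (dart H)) u p :
  potential A f -> [seq dsrc a | a <- c] = belast u p ->
  [seq dtgt a | a <- c] = p -> {subset [seq a.1 | a <- c] <= A} ->
  cycle_gain c = (f u * (f (last u p))^-1)%g.
Proof.
move=> fA; elim: c u p => [|a c IHc] u [|v p]//=.
  by rewrite /cycle_gain big_nil mulgV.
move=> [au cs] [av ct] cA.
rewrite /cycle_gain big_cons -/(cycle_gain c) (IHc v p)//; last first.
  by move=> e ec; apply: cA; rewrite inE ec orbT.
have -> : dgain a = (f u * (f v)^-1)%g.
  rewrite -au -av /dgain /dsrc /dtgt (fA a.1) ?cA ?mem_head//.
  by case: (a.2); rewrite // invMg invgK.
by rewrite mulgA mulgKV.
Qed.

Lemma path_darts (c : seq (dart H)) (a0 a : dart H) u p :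
  dtgt a0 = u -> [seq dsrc b | b <- c] = belast u p ->
  [seq dtgt b | b <- c] = p -> dsrc a = last u p ->
  path (fun a b => dtgt a == dsrc b) a0 (rcons c a).
Proof.
elim: c a0 u p => [|b c IHc] a0 u [|v p]//= a0u.
  by move=> _ _ ->; rewrite a0u eqxx.
by move=> [bu cs] [bv ct] av; rewrite a0u bu eqxx/=; apply: (IHc b v p).
Qed.

(** Induction on the number of edges. The removed edge [e] either closes a cycle, whose trivial gain
    is exactly the condition at [e], or joins two components, where the potential can be adjusted on
    one side. *)
Lemma balanced_potential A : balanced A -> exists f, potential A f.
Proof.
have [m] := ubnP #|A|; elim: m A => // m IHm A Am balA.
have [->|/set0Pn[e eA]] := eqVneq A finset.set0.
  by exists (fun=> 1%g) => e; rewrite inE.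
have A'A e' : e' \in A :\ e -> e' \in A by rewrite inE => /andP[].
have [||f fA] := IHm (A :\ e).
- by move: Am; rewrite (cardsD1 e A) eA.
- by move=> c cyc cA; apply: balA => // e' /cA/A'A.
have [/connectP[p0 /shortenP[p up uniqp _] lastp]|ncon] :=
  boolP (connect (linked (A :\ e)) (gtgt e) (gsrc e)).
  exists f => e' e'A; have [->|e'e] := eqVneq e' e; last by apply: fA; rewrite !inE e'e.
  (* The walk from the target of [e] back to its source completes [e] to a cycle. If [e] is a loop,
     the walk is empty and the cycle is [e] alone. *)
  have [c [cs ct cA cu]] := dart_walk up uniqp.
  have := balA ((e, false) :: c); rewrite /cycle_gain big_cons /= => H1.
  have := potential_walk fA cs ct cA; rewrite /cycle_gain => H2.
  move: H1; rewrite H2 /dgain/= -lastp => H1; apply/eqP.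
  rewrite eq_mulgV1 invMg invgK H1//; last first.
    by move=> e''; rewrite inE => /orP[/eqP->//|/cA/A'A].
  apply/and4P; split => //=.
  - by apply: (path_darts _ cs ct).
  - by rewrite /dsrc/= lastp cs; move: uniqp; rewrite lastI rcons_uniq.
  - by rewrite cu andbT; apply/negP => /cA; rewrite !inE eqxx.
(* [e] is a bridge: correcting [f] on the side of its target changes no gain
   condition other than that of [e]. *)
pose C v := connect (linked (A :\ e)) (gtgt e) v.
(* The solution of [gain e = f (gsrc e) * (f (gtgt e) * x)^-1]. Being a right factor, it cancels on
   edges with both ends in [C]. *)
pose x := ((f (gtgt e))^-1 * (gain e)^-1 * f (gsrc e))%g.
exists (fun v => if C v then (f v * x)%g else f v) => e' e'A.
have [->|e'e] := eqVneq e' e.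
  rewrite /C (negPf ncon) connect0 /x !mulgA mulgV mul1g invMg invgK mulgA.
  by rewrite mulgV mul1g.
have e'A' : e' \in A :\ e by rewrite !inE e'e.
have -> : C (gsrc e') = C (gtgt e').
  apply: (same_connect_r (sym_connect_sym (@linked_sym _))); apply: connect1.
  by apply/existsP; exists (e', false); rewrite e'A' /= /dsrc /dtgt/= !eqxx.
rewrite (fA e')//; case: ifP => // _.
by rewrite invMg mulgA mulgK.
Qed.

End Potential.

(** * The eigenbasis of a rotation *)

Section RootOfUnity.
Variable R : realType.

Lemma exp_omega n k : omega R n ^+ k =
  Complex (cos (2 * pi / n%:R *+ k)) (sin (2 * pi / n%:R *+ k)).
Proof.
elim: k => [|k IHk]; first by rewrite !mulr0n cos0 sin0.
rewrite exprSr IHk [in RHS]mulrSr cosD sinD /omega.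
by apply/eqP; rewrite eq_complex/= eqxx addrC/= eqxx.
Qed.

(** If the order [m] were less than [n], the half angle [x = pi m / n] would lie strictly between 0
    and [pi], so [sin x > 0], whereas [cos (2 x) = 1] forces [sin x = 0]. *)
Lemma omega_prim n : (0 < n)%N -> n.-primitive_root (omega R n).
Proof.
move=> n0; have nR : n%:R != 0 :> R by rewrite pnatr_eq0 -lt0n.
have on : omega R n ^+ n = 1.
  by rewrite exp_omega -mulr_natr divfK// mulr_natl cos2pi sin2pi.
have [m mprim mn] := prim_order_exists n0 on.
have m0 := prim_order_gt0 mprim.
have := dvdn_leq n0 mn; rewrite leq_eqVlt => /orP[/eqP mE|ltmn].
  by rewrite -{1}mE.
have := prim_expr_order mprim; rewrite exp_omega => /eqP.
rewrite eq_complex/= => /andP[/eqP cos1 _].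
pose x : R := pi / n%:R *+ m.
have xE : 2 * pi / n%:R *+ m = x *+ 2 by rewrite /x -mulrA mulr_natl mulrnAC.
have : 0 < sin x.
  apply: sin_gt0_pi; rewrite /x pmulrn_lgt0// divr_gt0 ?pi_gt0 ?ltr0n//=.
  by rewrite -mulr_natr mulrAC ltr_pdivrMr ?ltr0n// ltr_pM2l ?pi_gt0// ltr_nat.
move: cos1; rewrite xE cos_mulr2n => /(canRL (subrK _)) c2.
suff : sin x ^+ 2 = 0 by move/eqP; rewrite sqrf_eq0 => /eqP->; rewrite ltxx.
have : cos x ^+ 2 *+ 2 == 1 *+ 2 by rewrite c2.
by rewrite eqrMn2r/= sin2cos2 => /eqP->; rewrite subrr.
Qed.

End RootOfUnity.

Section Eigenbasis.
Variables (R : realType) (X : lmodType R).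

Lemma complexification_eta (z z' : complexification X) :
  z.1 = z'.1 -> z.2 = z'.2 -> z = z'.
Proof. by case: z z' => ? ? [? ?] /= -> ->. Qed.

Lemma sum_complexification (I : finType) (z : I -> complexification X) :
  \sum_i z i = (\sum_i (z i).1, \sum_i (z i).2) :> complexification X.
Proof.
by apply: complexification_eta; rewrite /=; elim/big_ind2 : _ => // a b c d <- <-.
Qed.

(** The eigenvalue [omega^-1] is written [omega ^+ n.-1], which keeps all exponents in [nat]. *)
Definition rotation_exponent n m (i : bool + 'I_m) : nat :=
  match i with inl true => 1 | inl false => n.-1 | inr _ => 0 end.

End Eigenbasis.

Lemma rotation_eigenbasis (R : realType) (X : vectType R) n
    (S : {linear X -> X}) : (0 < n)%N -> nfold_rotation n S ->
  exists (m : nat) (E : bool + 'I_m -> complexification X),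
  [/\ \dim {:X} = (m + 2)%N,
      forall i, extC S (E i) = omega R n ^+ rotation_exponent n i *: E i,
      forall a : bool + 'I_m -> R[i], \sum_i a i *: E i = 0 -> forall i, a i = 0
    & forall z, exists a : bool + 'I_m -> R[i], z = \sum_i a i *: E i].
Proof.
move=> n0 rotS.
(* The planar case joins the general one with [Z = 0]. *)
have [Y [Z [YZ YZ0 dY [b1 [b2 [bY Sb1 Sb2]]] SZ]]] :
    exists Y Z : {vspace X}, [/\ (Y + Z)%VS = {:X}%VS, (Y :&: Z)%VS = 0%VS,
    \dim Y = 2%N, rotation_on n Y S & forall z, z \in Z -> S z = z].
  case: rotS => [[dX rot]|[_ //]]; exists fullv, 0%VS; rewrite addv0 capv0.
  by split=> // z; rewrite memv0 => /eqP->; rewrite linear0.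
set t : R := 2 * pi / n%:R in Sb1 Sb2.
have spanX x : exists c1 c2 (c : 'I_(\dim Z) -> R),
    x = c1 *: b1 + c2 *: b2 + \sum_i c i *: (vbasis Z)`_i.
  have : x \in (Y + Z)%VS by rewrite YZ memvf.
  move=> /memv_addP[y yY [z zZ ->]].
  have := yY; rewrite -(span_basis bY) => yb.
  have -> := coord_span (X := [tuple b1; b2]) yb.
  rewrite big_ord_recl big_ord1/=.
  do 2 eexists; exists (fun i => coord (vbasis Z) i z).
  by congr (_ + _); exact: coord_vbasis.
have freeX c1 c2 (c : 'I_(\dim Z) -> R) :
    c1 *: b1 + c2 *: b2 + \sum_i c i *: (vbasis Z)`_i = 0 ->
    [/\ c1 = 0, c2 = 0 & forall i, c i = 0].
  set y := _ + c2 *: b2; set z := \sum_i _ => /eqP; rewrite addr_eq0 => /eqP yz.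
  have zZ : z \in Z.
    apply: memv_suml => i _; apply: memvZ; apply: (basis_mem (vbasisP Z)).
    by rewrite mem_nth// size_tuple.
  have yY : y \in Y.
    by rewrite memvD// memvZ// (basis_mem bY)// !inE eqxx ?orbT.
  have y0 : y = 0.
    by apply/eqP; rewrite -memv0 -YZ0 memv_cap yY yz memvN zZ.
  have z0 : z = 0 by apply/eqP; rewrite -oppr_eq0 -yz y0.
  have fb : free [tuple b1; b2] by apply: (basis_free bY).
  have /freeP/(_ (fun i => [:: c1; c2]`_i)) := fb.
  rewrite big_ord_recl big_ord1/= => /(_ y0) cb.
  split; [exact: (cb ord0)|exact: (cb (lift ord0 ord0))|].
  by have /freeP/(_ c z0) := basis_free (vbasisP Z).
(* b1 -+ i b2 are the eigenvectors of the rotation, for omega and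
   omega^-1 = omega^(n-1). *)
pose E (i : bool + 'I_(\dim Z)) : complexification X :=
  match i with
  | inl true => (b1, - b2) | inl false => (b1, b2) | inr i => ((vbasis Z)`_i, 0)
  end.
(* In the real basis, independence and spanning of [E] become small real linear systems for the real
   and imaginary parts of the coefficients. *)
have sumE (a : bool + 'I_(\dim Z) -> R[i]) : \sum_i a i *: E i =
   (((complex.Re (a (inl true)) + complex.Re (a (inl false))) *: b1
     + (complex.Im (a (inl true)) - complex.Im (a (inl false))) *: b2
     + \sum_i complex.Re (a (inr i)) *: (vbasis Z)`_i),
    ((complex.Im (a (inl true)) + complex.Im (a (inl false))) *: b1
     + (complex.Re (a (inl false)) - complex.Re (a (inl true))) *: b2
     + \sum_i complex.Im (a (inr i)) *: (vbasis Z)`_i)).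
  rewrite sum_complexification !big_sumType/= !big_bool/=.
  congr (_, _); congr (_ + _).
  - by rewrite scalerN opprK !scalerDl scaleNr; apply: addrACA.
  - by apply: eq_bigr => i _; rewrite scaler0 subr0.
  - rewrite scalerN !scalerDl scaleNr [- _ + _]addrC [X in _ + X]addrC addrACA.
    by congr (_ + _); rewrite addrC.
  - by apply: eq_bigr => i _; rewrite scaler0 add0r.
exists (\dim Z), E; split.
- by rewrite -YZ dimv_disjoint_sum// dY addnC.
(* Both sides are inverse to [omega]: the left one because [omega ^+ n = 1], the right one because
   [omega] has modulus 1. *)
- have oV : omega R n ^+ n.-1 = Complex (cos t) (- sin t).
    have oinv : omega R n * Complex (cos t) (- sin t) = 1.
      apply/eqP; rewrite eq_complex/= -/t mulrN opprK -!expr2 cos2Dsin2 eqxx/=.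
      by rewrite mulrN addrC mulrC subrr.
    rewrite -[LHS]mulr1 -oinv mulrA -exprSr prednK//.
    by rewrite (prim_expr_order (omega_prim R n0)) mul1r.
  case=> [[]|i]; rewrite /rotation_exponent ?expr1 ?expr0 ?oV;
    apply: complexification_eta; rewrite /= -/t.
  + by rewrite Sb1 scalerN opprK.
  + by rewrite linearN Sb2 scalerN opprD scaleNr opprK addrC.
  + by rewrite Sb1 /= scaleNr opprK.
  + by rewrite Sb2/= addrC.
  + rewrite SZ /= ?scale1r ?scale0r ?subr0// (basis_mem (vbasisP Z))//.
    by rewrite mem_nth// size_tuple.
  + by rewrite linear0 /= scaler0 scale0r addr0.
- move=> a; rewrite sumE => /(congr1 (fun z : X * X => (z.1, z.2)))/= -[].
  move=> /freeX[t1 t2 t3] /freeX[t4 t5 t6].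
  case=> [[]|i]; apply/eqP; rewrite eq_complex ?t3 ?t6 ?eqxx//=.
  + by apply/andP; split; apply/eqP; lra.
  + by apply/andP; split; apply/eqP; lra.
- case=> x y; have [x1 [x2 [xc ->]]] := spanX x; have [y1 [y2 [yc ->]]] := spanX y.
  (* The solution of the systems displayed in [sumE]. *)
  exists (fun i => match i with
    | inl true => Complex ((x1 - y2) / 2) ((y1 + x2) / 2)
    | inl false => Complex ((x1 + y2) / 2) ((y1 - x2) / 2)
    | inr i => Complex (xc i) (yc i) end).
  rewrite sumE/=; congr (_ *: _ + _ *: _ + _, _ *: _ + _ *: _ + _); lra.
Qed.

(** * The differential of the rigidity map *)

Section RigidityOperator.
Local Open Scope classical_set_scope.
Variables (R : realType) (X : normedModType R) (gT : finGroupType).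
Variable S : sym_framework X gT.
Hypothesis wp : well_positioned S.
Implicit Types (x : {ffun vertex S -> X}) (z : {ffun vertex S -> complexification X}).

Lemma edge_ends (e : edge S) : exists v w, val e = [set v; w]%SET.
Proof.
by have /eqP/cards2P[v [w [_ ->]]] := edges_card2 (valP e); exists v, w.
Qed.

(** The maximum norm on the target bounds every coordinate, so the directional derivative can be
    taken one edge at a time. *)
Lemma rigidity_operator_cvg x (e : edge S) :
  h^-1 *: (rigidity_map (h *: x + pos S) e - rigidity_map (pos S) e)
    @[h --> (0 : R)^'] --> (rigidity_operator (S := S) x e : R^o).
Proof.
have dS : differentiable (@rigidity_map R X S) (pos S) by exact: wp.
have := @diff_derivable _ _ _ _ _ x dS.
rewrite /derivable => /cvg_ex[l cvl].
have lE : l = rigidity_operator (S := S) x.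
  rewrite /rigidity_operator -(deriveE x dS); apply/esym.
  exact: (cvg_lim (@norm_hausdorff _ _) cvl).
apply/cvgrPdist_lt => eps eps0; move/cvgrPdist_lt: cvl => /(_ eps eps0).
apply: filterS => h; rewrite -lE; apply: le_lt_trans.
have := ler_ffun_norm (l - h^-1 *: ((@rigidity_map R X S \o shift (pos S)) (h *: x)
  - rigidity_map (pos S))) e.
by rewrite !ffunE.
Qed.

(** Equal edge lengths along two lines through [pos S] give equal difference quotients. This yields
    locality and equivariance with no formula for the derivative of the norm. *)
Lemma rigidity_operator_uniq x x' (e e' : edge S) :
  (forall h, rigidity_map (h *: x + pos S) e = rigidity_map (h *: x' + pos S) e') ->
  rigidity_operator (S := S) x e = rigidity_operator (S := S) x' e'.
Proof.
move=> xx'; have := @rigidity_operator_cvg x' e'.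
under eq_fun => h do rewrite -xx'.
have := xx' 0; rewrite !scale0r !add0r => <-.
by apply: (cvg_unique _ (@rigidity_operator_cvg x e)).
Qed.

Lemma rigidity_operator_local x (e : edge S) v w :
  val e = [set v; w]%SET -> x v = x w -> rigidity_operator (S := S) x e = 0.
Proof.
move=> evw xvw.
have -> : rigidity_operator (S := S) x e = rigidity_operator (S := S) 0 e.
  apply: rigidity_operator_uniq => h; rewrite !(rigidity_mapE _ evw) !ffunE xvw.
  by rewrite scaler0 !add0r opprD addrACA subrr add0r.
by rewrite /rigidity_operator linear0 ffunE.
Qed.

(** The isometry [tau S g] maps the edge [e] displaced along [x] onto its image displaced along
    [x'], so the two lengths agree for every step [h]. *)
Lemma rigidity_operator_equiv g x x' (e : edge S) :
  (forall v, x' (theta S g v) = tau S g (x v)) ->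
  rigidity_operator (S := S) x' (edge_act g e) = rigidity_operator (S := S) x e.
Proof.
move=> xx'; apply: rigidity_operator_uniq => h.
have [v [w evw]] := edge_ends e.
have evw' : val (edge_act g e) = [set theta S g v; theta S g w]%SET.
  by rewrite /= evw imsetU1 imset_set1.
rewrite (rigidity_mapE _ evw) (rigidity_mapE _ evw') !ffunE !xx' -!tau_pos.
by rewrite -[RHS](tau_isom S g) linearB !linearD !linearZ.
Qed.

Lemma rigidity_operatorC_linear : linear (rigidity_operatorC (S := S)).
Proof.
move=> c z z'; apply/ffunP => e; rewrite !ffunE.
have -> : [ffun v => ((c *: z + z') v).1] = complex.Re c *: [ffun v => (z v).1]
    - complex.Im c *: [ffun v => (z v).2] + [ffun v => (z' v).1].
  by apply/ffunP => v; rewrite !ffunE/=.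
have -> : [ffun v => ((c *: z + z') v).2] = complex.Re c *: [ffun v => (z v).2]
    + complex.Im c *: [ffun v => (z v).1] + [ffun v => (z' v).2].
  by apply/ffunP => v; rewrite !ffunE/=.
rewrite /rigidity_operator !linearD linearN !linearZ !ffunE.
by case: c => a b /=; apply/eqP; rewrite eq_complex /= -mulrN !eqxx.
Qed.

Lemma rigidity_operatorC_local z (e : edge S) v w :
  val e = [set v; w]%SET -> z v = z w -> rigidity_operatorC z e = 0.
Proof.
by move=> evw zvw; rewrite ffunE !(rigidity_operator_local evw) // !ffunE zvw.
Qed.

Lemma rigidity_operatorC_equiv g c z
    (e : edge S) :
  (forall v, z (theta S g v) = c *: extC (tau S g) (z v)) ->
  rigidity_operatorC z (edge_act g e) = c * rigidity_operatorC z e.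
Proof.
move=> zE; rewrite !ffunE.
(* Multiplication by [c] mixes the two real components, so the real equivariance is applied to the
   real and imaginary parts of [c *: z]. *)
rewrite (@rigidity_operator_equiv g (complex.Re c *: [ffun v => (z v).1]
  - complex.Im c *: [ffun v => (z v).2])); last first.
  by move=> v; rewrite !ffunE zE/= linearB !linearZ.
rewrite (@rigidity_operator_equiv g (complex.Re c *: [ffun v => (z v).2]
  + complex.Im c *: [ffun v => (z v).1])); last first.
  by move=> v; rewrite !ffunE zE/= linearD !linearZ.
rewrite /rigidity_operator !linearD linearN !linearZ !ffunE.
by case: c {zE} => a b /=; apply/eqP; rewrite eq_complex /= -mulrN !eqxx.
Qed.

End RigidityOperator.

(** * Infinitesimal motions and constant fields *)

Section InfinitesimalMotions.
Local Open Scope classical_set_scope.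
Variables (R : realType) (X : normedModType R).

Lemma inf_motions_cst (a : X) : inf_motions (fun=> a).
Proof.
exists (fun x t => x + t *: a).
  split=> [x|x|x y t _]; last 1 first.
  - by rewrite opprD addrACA subrr addr0.
  - apply: continuous_subspaceT => t.
    by apply: cvgD; [exact: cvg_cst|apply: cvgZr_tmp; exact: cvg_id].
  - by rewrite scale0r addr0.
move=> x.
have cvgq : h^-1 *: ((fun t : R^o => x + t *: a) (h *: 1 + 0)
    - (fun t : R^o => x + t *: a) 0) @[h --> (0 : R^o)^'] --> a.
  apply: cvg_near_cst; near=> h.
  have h0 : h != 0 by near: h; exact: nbhs_dnbhs_neq.
  rewrite addr0 scale0r addr0 addrC addKr scalerA.
  by rewrite -[h%:A]/(h * 1) mulr1 mulVf// scale1r.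
apply: DeriveDef; first by apply/cvg_ex; exists a.
exact: (cvg_lim (@norm_hausdorff _ _) cvgq).
Unshelve. all: by end_near.
Qed.

(** Translations make every constant real field a motion, and minimality leaves no others; over the
    complex numbers these span all constants, and equivariance becomes invariance of the value. *)
Lemma T_chi_minimal (gT : finGroupType) (S : sym_framework X gT)
    (chi : gT -> R[i]) eta : inf_motions_minimal X ->
  T_chi S chi eta <-> exists2 a, eta = cst a
    & forall g, a = chi g *: extC (tau S g) a.
Proof.
move=> minX; split=> [[[k [c [h [hI etaE]]]] etaS]|[[x y] -> aS]].
  have /choice[a ha] i : exists a, forall x, h i x = a by exact: minX.
  exists (\sum_(i < k) c i *: oneC (a i)).
    by apply/funext => x; rewrite etaE; apply: eq_bigr => i _; rewrite ha.
  have etaE' x : eta x = \sum_(i < k) c i *: oneC (a i).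
    by rewrite etaE; apply: eq_bigr => i _; rewrite ha.
  by move=> g; have := etaS g 0; rewrite !etaE'.
split; last by move=> g z; exact: aS.
(* The vector [(x, y)] is [1 x + i y], a combination of two real translations. *)
exists 2%N, (fun i => if i == ord0 then 1 else Complex 0 1).
exists (fun i _ => if i == ord0 then x else y); split.
  by move=> i; exact: inf_motions_cst.
move=> z; rewrite big_ord_recl big_ord1/= scale1r.
apply: complexification_eta => /=; rewrite ?scale0r ?scaler0 ?scale1r.
  by rewrite subr0 addr0.
by rewrite add0r add0r.
Qed.

End InfinitesimalMotions.

(** * Orbits and gains *)

Section Orbits.
Variables (gT : finGroupType) (G : symgraph gT) (c : gain_choice G).
Implicit Types (g h : gT) (v : vertex G) (e : edge G).

Lemma theta1 v : theta G 1%g v = v.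
Proof. by apply: (@perm_inj _ (theta G 1%g)); rewrite -thetaM mulg1. Qed.

Lemma theta_inj v g h : theta G g v = theta G h v -> g = h.
Proof.
move=> gh; apply/eqP; rewrite eq_mulVg1; apply/eqP/(@theta_free _ _ _ v).
by rewrite thetaM -gh -thetaM mulVg theta1.
Qed.

Lemma edge_actM g h e : edge_act (g * h)%g e = edge_act g (edge_act h e).
Proof.
apply: val_inj => /=; rewrite -imset_comp; apply: eq_imset => v /=.
exact: thetaM.
Qed.

Lemma edge_act1 e : edge_act 1%g e = e.
Proof.
by apply: val_inj => /=; rewrite (eq_imset _ (theta1 )) imset_id.
Qed.

Lemma vorbit_subproof v : [set theta G g v | g : gT]%SET \in vertex_orbits G.
Proof. by apply/imsetP; exists v. Qed.

Definition vorbit v : qvertex G :=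
  exist (fun A => A \in vertex_orbits G) _ (vorbit_subproof v).

Lemma vorbit_theta g v : vorbit (theta G g v) = vorbit v.
Proof.
apply: val_inj; apply/setP => u /=; apply/imsetP/imsetP => -[h _ ->].
  by exists (h * g)%g; rewrite ?thetaM.
by exists (h * g^-1)%g; rewrite // -thetaM mulgKV.
Qed.

Lemma vorbit_rep a : vorbit (gc_rep c a) = a.
Proof.
have := gc_repP c a; have /imsetP[v _ aE] := valP a.
by rewrite aE => /imsetP[g _ ->]; rewrite vorbit_theta; apply: val_inj.
Qed.

Lemma vorbit_gain v : {g | v = theta G g (gc_rep c (vorbit v))}.
Proof.
apply: cid; have /imsetP[g _ ->] := gc_repP c (vorbit v).
by exists g^-1%g; rewrite -thetaM mulVg theta1.
Qed.

(** Freeness on vertices makes this element unique, so [vorbit] and [vgain] together are coordinates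
    on the vertices. *)
Definition vgain v : gT := sval (vorbit_gain v).

Lemma vgainE v : theta G (vgain v) (gc_rep c (vorbit v)) = v.
Proof. by rewrite /vgain; case: vorbit_gain. Qed.

Lemma vgain_theta g v : vgain (theta G g v) = (g * vgain v)%g.
Proof.
apply: (@theta_inj (gc_rep c (vorbit v))).
by rewrite -{1}(vorbit_theta g) vgainE thetaM vgainE.
Qed.

Lemma vgain_rep a : vgain (gc_rep c a) = 1%g.
Proof.
apply: (@theta_inj (gc_rep c (vorbit (gc_rep c a)))).
by rewrite vgainE theta1 vorbit_rep.
Qed.

Lemma eorbit_subproof e : [set theta G g @: val e | g : gT]%SET \in edge_orbits G.
Proof. by apply/imsetP; exists (val e); first exact: (valP e). Qed.

Definition eorbit e : qedge G :=
  exist (fun A => A \in edge_orbits G) _ (eorbit_subproof e).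

Lemma eorbit_act g e : eorbit (edge_act g e) = eorbit e.
Proof.
have vact h e' : theta G h @: val e' = val (edge_act h e') by [].
apply: val_inj; apply/setP => u /=; apply/imsetP/imsetP => -[h _ ->].
  by exists (h * g)%g => //; rewrite !vact edge_actM.
by exists (h * g^-1)%g => //; rewrite !vact -edge_actM mulgKV.
Qed.

Lemma erep_subproof (a : qedge G) :
  [set gc_rep c (gc_src c a); theta G (gc_gain c a) (gc_rep c (gc_tgt c a))]%SET
    \in edges G.
Proof.
have := gc_gainP c a; have /imsetP[e eG ->] := valP a => /imsetP[g _ ->].
by rewrite theta_edges.
Qed.

(** This representative has the ends prescribed by [gc_gainP], so the gain appears in its row. *)
Definition erep (a : qedge G) : edge G :=
  exist (fun B => B \in edges G) _ (erep_subproof a).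

Lemma eorbit_rep a : eorbit (erep a) = a.
Proof.
have := gc_gainP c a; have /imsetP[e eG aE] := valP a.
rewrite aE => /imsetP[g _ eE].
have -> : erep a = edge_act g (exist (fun B => B \in edges G) e eG) by apply: val_inj.
by rewrite eorbit_act; apply: val_inj.
Qed.

Lemma eorbit_gain e : {g | e = edge_act g (erep (eorbit e))}.
Proof.
apply: cid; have /imsetP[g _ eE] := gc_gainP c (eorbit e).
exists g^-1%g; have -> : erep (eorbit e) = edge_act g e by apply: val_inj.
by rewrite -edge_actM mulVg edge_act1.
Qed.

(** Unlike [vgain], it is determined only up to the stabilizer of the representative, which is
    nontrivial when a group element swaps its ends. *)
Definition egain e : gT := sval (eorbit_gain e).

Lemma egainE e : edge_act (egain e) (erep (eorbit e)) = e.
Proof. by rewrite /egain; case: eorbit_gain. Qed.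

End Orbits.

(** * Sparsity for diagonalizable actions *)

Section DiagonalAction.
Variables (R : realType) (X : normedModType R) (gT : finGroupType).
Variables (S : sym_framework X gT) (psi : gain_choice S).
Variables (chi : gT -> R[i]) (K : finType).
Variables (E : K -> complexification X) (mu : K -> gT -> R[i]).
Hypothesis chiM : forall g h, chi (g * h)%g = chi g * chi h.
Hypothesis chi1 : chi 1%g = 1.
Hypothesis muM : forall i g h, mu i (g * h)%g = mu i g * mu i h.
Hypothesis mu1 : forall i, mu i 1%g = 1.
Hypothesis Efree : forall a : K -> R[i], \sum_i a i *: E i = 0 -> forall i, a i = 0.
Hypothesis Espan : forall z, exists a : K -> R[i], z = \sum_i a i *: E i.
Hypothesis Eeigen : forall i g, chi g *: extC (tau S g) (E i) = mu i g *: E i.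
Hypothesis chi_stab : forall g h (e : edge S),
  edge_act g e = edge_act h e -> chi g = chi h.
Hypothesis wp : well_positioned S.
Hypothesis minX : inf_motions_minimal X.
Hypothesis iso : sym_isostatic S chi.

Local Notation V0 := (qvertex S).
Local Notation E0 := (qedge S).
Local Notation W := {ffun V0 * K -> R[i]^o}.
Implicit Types (w : W) (a : K -> R[i]) (A : {set E0}) (P : {set K}).

Lemma twist_sum g a :
  chi g *: extC (tau S g) (\sum_i a i *: E i) = \sum_i (mu i g * a i) *: E i.
Proof.
have extC0 : extC (tau S g) 0 = 0.
  by apply: complexification_eta; rewrite /= linear0.
have extCD : {morph extC (tau S g) : z z' / z + z'}.
  by move=> z z'; apply: complexification_eta; rewrite /= linearD.
have extCZ b z : extC (tau S g) (b *: z) = b *: extC (tau S g) z.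
  by apply: complexification_eta; rewrite /= ?linearD ?linearN !linearZ.
rewrite (big_morph _ extCD extC0) scaler_sumr; apply: eq_bigr => i _.
have -> : chi g *: extC (tau S g) (a i *: E i) =
    a i *: (chi g *: extC (tau S g) (E i)) by rewrite extCZ !scalerA mulrC.
by rewrite Eeigen scalerA mulrC.
Qed.

Lemma eigen_coord_inj a b :
  \sum_i a i *: E i = \sum_i b i *: E i -> forall i, a i = b i.
Proof.
move=> ab i; apply/eqP; rewrite -subr_eq0; apply/eqP.
apply: (Efree (a := fun i => a i - b i)).
under eq_bigr => k _ do rewrite scalerBl.
by rewrite sumrB ab subrr.
Qed.

(** A member of [X_chi] is determined by its eigencoordinates at the orbit representatives; [mu]
    transports them along each orbit. *)
Definition lift w : {ffun vertex S -> complexification X} :=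
  [ffun v => \sum_i (mu i (vgain psi v) * w (vorbit v, i)) *: E i].

Lemma lift_linear : linear lift.
Proof.
move=> b w w'; apply/ffunP => v; rewrite !ffunE scaler_sumr -big_split/=.
by apply: eq_bigr => i _; rewrite !ffunE scalerA -scalerDl mulrDr mulrCA.
Qed.

Lemma lift_theta w g v :
  lift w (theta S g v) = \sum_i (mu i (g * vgain psi v)%g * w (vorbit v, i)) *: E i.
Proof. by rewrite ffunE vgain_theta vorbit_theta. Qed.

Lemma lift_rep w x : lift w (gc_rep psi x) = \sum_i w (x, i) *: E i.
Proof.
rewrite ffunE vgain_rep vorbit_rep.
by apply: eq_bigr => i _; rewrite mu1 mul1r.
Qed.

Lemma lift_theta_rep w g x :
  lift w (theta S g (gc_rep psi x)) = \sum_i (mu i g * w (x, i)) *: E i.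
Proof. by rewrite lift_theta vgain_rep vorbit_rep mulg1. Qed.

Lemma lift_X_chi w : X_chi chi (lift w).
Proof.
move=> g v; rewrite lift_theta [in RHS]ffunE twist_sum.
by apply: eq_bigr => i _; rewrite muM mulrA.
Qed.

Lemma X_chi_lift z : X_chi chi z -> exists w, z = lift w.
Proof.
move=> zX; have /choice[a aE] := fun x => Espan (z (gc_rep psi x)).
exists [ffun x => a x.1 x.2]; apply/ffunP => v.
rewrite ffunE -{1}(vgainE psi v) zX aE twist_sum.
by apply: eq_bigr => i _; rewrite ffunE.
Qed.

(** The orbit rigidity matrix: [R_chi] in coordinates, with one row for each edge orbit. *)
Definition quotient_rigidity w : {ffun E0 -> R[i]^o} :=
  [ffun x => rigidity_operatorC (lift w) (erep psi x)].

Lemma quotient_rigidity_linear : linear quotient_rigidity.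
Proof.
move=> b w w'; apply/ffunP => x.
by rewrite [LHS]ffunE lift_linear rigidity_operatorC_linear !ffunE.
Qed.

HB.instance Definition _ := GRing.isLinear.Build R[i] W {ffun E0 -> R[i]^o} _
  quotient_rigidity quotient_rigidity_linear.

Lemma quotient_rigidity_surj y : exists w, quotient_rigidity w = y.
Proof.
(* By [chi_stab] the factor does not depend on the choice made by [egain]. *)
pose y' : {ffun edge S -> R[i]} := [ffun e => chi (egain psi e) * y (eorbit e)].
have y'Y : Y_chi chi y'.
  move=> g e; rewrite !ffunE eorbit_act mulrA -chiM; congr (_ * _).
  apply: (@chi_stab _ _ (erep psi (eorbit e))).
  by rewrite [RHS]edge_actM egainE -[RHS](egainE psi) eorbit_act.
have [z zX zy] := iso.2 _ y'Y; have [w zw] := X_chi_lift zX.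
exists w; apply/ffunP => x; rewrite ffunE -zw zy ffunE eorbit_rep.
rewrite (@chi_stab _ 1%g (erep psi x)) ?chi1 ?mul1r//.
by have := egainE psi (erep psi x); rewrite eorbit_rep edge_act1.
Qed.

(** The two sides of the hypothesis are the eigencoordinates of [lift w] at the two ends of
    [erep psi x], so locality applies. *)
Lemma quotient_rigidity_flat w x :
  (forall i, w (gc_src psi x, i) = mu i (gc_gain psi x) * w (gc_tgt psi x, i)) ->
  quotient_rigidity w x = 0.
Proof.
move=> wx; rewrite ffunE; apply: (rigidity_operatorC_local wp (e := erep psi x)).
  by [].
by rewrite lift_rep lift_theta_rep; apply: eq_bigr => i _; rewrite wx.
Qed.

(* On a lift of such a section the gain condition
   [mu i (p (src x)) = mu i (gain x * p (tgt x))] makes both ends of the edges in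
   the orbit [x] move by the same vector. *)
Definition flat_section P (p : V0 -> gT) (u : {ffun {i | i \in P} -> R[i]^o}) : W :=
  [ffun x => mu x.2 (p x.1) * (if insub x.2 is Some i then u i else 0)].

Lemma flat_section_linear P p : linear (@flat_section P p).
Proof.
move=> b u u'; apply/ffunP => -[x i]; rewrite !ffunE/=; case: insubP => [j _ _|_].
  by rewrite !ffunE mulrDr; congr (_ + _); rewrite mulrCA.
by rewrite mulr0 scaler0 addr0.
Qed.

HB.instance Definition _ P p := GRing.isLinear.Build R[i]
  {ffun {i | i \in P} -> R[i]^o} W _
  (@flat_section P p) (@flat_section_linear P p).

(** Values of the multiplicative function [mu i] are nonzero, so [u] can be recovered at any one
    vertex orbit. *)
Lemma flat_section_inj P p (u : {ffun {i | i \in P} -> R[i]^o}) x :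
  (forall i, flat_section p u (x, i) = 0) -> u = 0.
Proof.
move=> ux; apply/ffunP => i; rewrite ffunE.
have := ux (val i); rewrite ffunE/= valK => /eqP; rewrite mulf_eq0 => /orP[|/eqP//].
move=> /eqP mu0; have := muM (val i) (p x) (p x)^-1%g.
by rewrite mu0 mul0r mulgV mu1 => /eqP; rewrite oner_eq0.
Qed.

Lemma quotient_flat_section P p u x :
  (forall i, i \in P ->
    mu i (p (gc_src psi x)) = mu i (gc_gain psi x * p (gc_tgt psi x))%g) ->
  quotient_rigidity (@flat_section P p u) x = 0.
Proof.
move=> px; apply: quotient_rigidity_flat => i; rewrite !ffunE/=.
case: insubP => [j iP _|_]; last by rewrite !mulr0.
by rewrite px// muM mulrA.
Qed.

Local Notation H := (gain_graph_of psi).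

(** Common source of both sparsity bounds: a potential allows [P] to be everything, and the trivial
    [p] allows the invariant indices. *)
Lemma sparse_of_flat A P (p : V0 -> gT) : A != finset.set0 ->
  (forall x i, x \in A -> i \in P ->
    mu i (p (gc_src psi x)) = mu i (gc_gain psi x * p (gc_tgt psi x))%g) ->
  (#|A| + #|P| <= #|K| * #|vsupport (H := H) A|)%N.
Proof.
move=> A0 pA; have := @incidence_count _ V0 E0 K {i | i \in P}
  quotient_rigidity (gc_src psi) (gc_tgt psi) quotient_rigidity_surj.
rewrite card_sig mulnC => /(_ _ A (@flat_section P p)); apply=> //.
- move=> w x ws wt; apply: quotient_rigidity_flat => i.
  by rewrite ws wt mulr0.
- by move=> u v; exact: flat_section_inj.
- by move=> u x xA; apply: quotient_flat_section => i; exact: pA.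
Qed.

Lemma balanced_sparse A : A != finset.set0 -> balanced (H := H) A ->
  (#|A| + #|K| <= #|K| * #|vsupport (H := H) A|)%N.
Proof.
move=> A0 /balanced_potential[p pA]; rewrite -[X in (_ + X)%N]cardsT.
apply: (sparse_of_flat (p := p)) => // x i xA _.
by rewrite -[gc_gain psi x]/(gain (x : gedge H)) pA// mulgKV.
Qed.

Definition invariant_indices : {set K} := [set i | [forall g, mu i g == 1]].

Lemma invariant_indicesP i :
  reflect (forall g, mu i g = 1) (i \in invariant_indices).
Proof.
by rewrite inE; apply: (iffP forallP) => h g; apply/eqP; rewrite h.
Qed.

Lemma invariant_sparse A : A != finset.set0 ->
  (#|A| + #|invariant_indices| <= #|K| * #|vsupport (H := H) A|)%N.
Proof.
move=> A0; apply: (sparse_of_flat (p := fun=> 1%g)) => // x i _.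
by move=> /invariant_indicesP muE; rewrite !muE.
Qed.

Lemma tight_count : (#|E0| + #|invariant_indices| = #|K| * #|V0|)%N.
Proof.
have := @dim_surjective_eq _ _ _ _ quotient_rigidity
  (@flat_section invariant_indices (fun=> 1%g)).
rewrite !dim_ffun_regular (card_sig (mem invariant_indices)) card_prod mulnC; apply.
- exact: quotient_rigidity_surj.
- have /card_gt0P[v _] := vertex_nonempty S.
  move=> u u0; apply: (@flat_section_inj _ (fun=> 1%g) _ (vorbit v)) => i.
  by rewrite u0 ffunE.
- move=> u; apply/ffunP => x; rewrite quotient_flat_section ?ffunE//.
  by move=> i /invariant_indicesP muE; rewrite !muE.
move=> w w0.
(* Every row is a multiple of the row of its orbit representative, so [lift w] is in the kernel of
   [R_chi] and hence comes from an invariant constant. *)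
have : [set z | X_chi chi z /\ rigidity_operatorC z = 0]%classic (lift w).
  split; first exact: lift_X_chi.
  apply/ffunP => e; rewrite [RHS]ffunE -(egainE psi e).
  rewrite (rigidity_operatorC_equiv wp _ (lift_X_chi w _)).
  by move/ffunP: w0 => /(_ (eorbit e)); rewrite !ffunE => ->; rewrite mulr0.
rewrite iso.1 => -[eta /(T_chi_minimal _ _ _ minX)[z -> zinv] wz].
have [a aE] := Espan z.
(* Invariance of [z] reads [a i = mu i g * a i] for all [g]. *)
have ainv i : i \notin invariant_indices -> a i = 0.
  move=> iN; apply/eqP; apply: contraNT iN => ai0; apply/invariant_indicesP => g.
  have := zinv g; rewrite aE twist_sum => /eigen_coord_inj/(_ i) aiE.
  by apply: (mulIf ai0); rewrite -aiE mul1r.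
exists [ffun i => a (val i)]; apply/ffunP => -[x i].
have -> : w (x, i) = a i.
  have : lift w (gc_rep psi x) = z by rewrite -wz ffunE.
  by rewrite lift_rep aE => /eigen_coord_inj.
rewrite ffunE mu1 mul1r /=; case: insubP => [j _ jE|/ainv//].
by rewrite ffunE jE.
Qed.

End DiagonalAction.

(** * Cyclic groups *)

Lemma expr_Zp_add (F : nzRingType) n (z : F) a (g h : 'Z_n) :
  (1 < n)%N -> z ^+ n = 1 -> z ^+ (a * (g * h)%g) = z ^+ (a * g) * z ^+ (a * h).
Proof.
(* The modulus built into ['Z_n] is [(Zp_trunc n).+2], which equals [n] since [1 < n]. *)
move=> n1 zn; have -> : (g * h)%g = ((g + h) %% n)%N :> nat.
  transitivity ((g + h) %% (Zp_trunc n).+2)%N; first by [].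
  by congr (_ %% _)%N; exact: Zp_cast.
by rewrite mulnC exprM expr_mod// -exprM mulnC mulnDr exprD.
Qed.

Lemma tau_eigenvector (R : realType) (X : normedModType R) n
    (S : sym_framework X 'Z_n) (z : complexification X) (c : R[i]) (g : 'Z_n) :
  extC (tau S (1 : 'Z_n)%R) z = c *: z -> extC (tau S g) z = c ^+ g *: z.
Proof.
move=> z1; rewrite -{1}(natr_Zp g); elim: (g : nat) => [|k IHk].
  by rewrite expr0 scale1r; apply: complexification_eta; exact: tau1.
have -> : (k.+1%:R : 'Z_n) = ((1 : 'Z_n)%R * (k%:R : 'Z_n)%R)%g by rewrite mulrS.
have -> : extC (tau S ((1 : 'Z_n)%R * (k%:R : 'Z_n)%R)%g) z =
    extC (tau S (1 : 'Z_n)%R) (extC (tau S (k%:R : 'Z_n)%R) z).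
  by apply: complexification_eta; exact: tauM.
have extCZ b y : extC (tau S (1 : 'Z_n)%R) (b *: y) =
    b *: extC (tau S (1 : 'Z_n)%R) y.
  by apply: complexification_eta; rewrite /= ?linearD ?linearN !linearZ.
by rewrite IHk extCZ z1 scalerA -exprSr.
Qed.

(** Uniform in [n] and [j]: the three terms of [m] count the trivial characters [mu i] coming from
    the eigenvalues [omega], [omega^-1] and, [d - 2] times, 1. A character is trivial when its value
    [omega ^+ (j + rotation_exponent n i)] at the generator is 1. *)
Lemma gain_tight_rotation (R : realType) (X : normedVectType R) (n j : nat)
    (S : sym_framework X 'Z_n) (psi : gain_choice S) :
  (2 <= n)%N -> (2 <= \dim {:X})%N -> well_positioned S -> Cn_symmetric S ->
  inf_motions_minimal X -> sym_isostatic S (@chi R n j) ->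
  (j <> 0%N -> edge_free S) ->
  let m := ((n %| j.+1) + (n %| j + n.-1) + (n %| j) * (\dim {:X} - 2))%N in
  gain_tight (gain_graph_of psi) (\dim {:X}) (\dim {:X}) m.
Proof.
move=> n2 d2 wp sym minX iso free m.
have n0 : (0 < n)%N by exact: ltnW.
have op := omega_prim R n0; have on := prim_expr_order op.
have [k [E [dimE Eeig Efree Espan]]] := rotation_eigenbasis n0 sym.
pose K : finType := (bool + 'I_k)%type.
pose mu (i : K) (g : 'Z_n) := omega R n ^+ ((j + rotation_exponent n i) * g).
have dimK : #|K| = \dim {:X} by rewrite card_sum card_bool card_ord dimE addnC.
have chiM (g h : 'Z_n) : @chi R n j (g * h)%g = chi R j g * chi R j h.
  exact: expr_Zp_add.
have chi1 : @chi R n j 1%g = 1 by rewrite /chi muln0.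
have muM (i : K) (g h : 'Z_n) : mu i (g * h)%g = mu i g * mu i h.
  exact: expr_Zp_add.
have mu1 (i : K) : mu i 1%g = 1 by rewrite /mu muln0.
have Eeigen (i : K) (g : 'Z_n) : chi R j g *: extC (tau S g) (E i) = mu i g *: E i.
  rewrite (tau_eigenvector g (Eeig i)) scalerA /chi /mu mulnDl exprD.
  by rewrite -exprM.
have stab (g h : 'Z_n) (e : edge S) :
    edge_act g e = edge_act h e -> chi R j g = chi R j h.
  have [->|/eqP j0] := eqVneq j 0%N; first by rewrite /chi !mul0n.
  move=> gh; congr chi; apply/eqP; rewrite eq_mulVg1; apply/eqP/(free j0 _ e).
  by rewrite edge_actM -gh -edge_actM mulVg edge_act1.
have invE : #|invariant_indices mu| = m.
  have inv i : (i \in invariant_indices mu) = (n %| j + rotation_exponent n i)%N.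
    rewrite (prim_order_dvd op).
    apply/invariant_indicesP/eqP => [/(_ (1 : 'Z_n)%R)|h g].
      by rewrite /mu muln1.
    by rewrite /mu exprM h expr1n.
  rewrite -sum1_card big_mkcond.
  rewrite (eq_bigr (fun i => (i \in invariant_indices mu) : nat)); last first.
    by move=> i _; case: ifP.
  rewrite big_sumType/= big_bool/= !inv /= addn1; congr (_ + _)%N.
  rewrite (eq_bigr (fun=> (n %| j)%N : nat)); last by move=> i _; rewrite inv /= addn0.
  by rewrite sum_nat_const card_ord mulnC dimE addnK.
have md : (m <= \dim {:X})%N by rewrite -dimK -invE max_card.
split; first split.
- by rewrite md mul2n -addnn -addnBA ?leq_addr// ltnW.
- move=> A A0 bal; rewrite -dimK.
  exact: (balanced_sparse chiM chi1 muM mu1 Espan Eeigen stab wp iso A0 bal).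
- move=> A A0; rewrite -invE -dimK.
  exact: (invariant_sparse psi chiM chi1 muM mu1 Espan Eeigen stab wp iso A0).
- rewrite -invE -dimK.
  exact: (tight_count psi chiM chi1 muM mu1 Efree Espan Eeigen stab wp minX iso).
Qed.

Theorem corollary2p20 (R : realType) (X : normedVectType R) (n d j : nat)
    (S : sym_framework X 'Z_n) (psi : gain_choice S)
    (n_ge2 : (2 <= n)%N)
    (dimX : \dim {:X} = d) (d_ge2 : (2 <= d)%N)
    (wp : well_positioned S)
    (sym : Cn_symmetric S)
    (minimal : inf_motions_minimal X)
    (j_lt_n : (j < n)%N)
    (iso : sym_isostatic S (@chi R n j))
    (free : j <> 0%N -> edge_free S) :
  (n = 2%N ->
     (j = 0%N -> gain_tight (gain_graph_of psi) d d (d - 2)) /\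
     (j = 1%N -> gain_tight (gain_graph_of psi) d d 2)) /\
  ((3 <= n)%N ->
     (j = 0%N -> gain_tight (gain_graph_of psi) d d (d - 2)) /\
     (j = 1%N \/ j = (n - 1)%N -> gain_tight (gain_graph_of psi) d d 1) /\
     (j <> 0%N /\ j <> 1%N /\ j <> (n - 1)%N ->
        gain_tight (gain_graph_of psi) d d 0)).
Proof.
rewrite -dimX in d_ge2 *.
have := gain_tight_rotation psi n_ge2 d_ge2 wp sym minimal iso free.
(* As [j < n], the divisibility conditions in [m] reduce to [j = 0], [j = n - 1] and [j = 1]. *)
have dvd0 : (n %| j)%N = (j == 0%N).
  by case: j j_lt_n {iso free} => [|j] jn; rewrite ?dvdn0 ?gtnNdvd.
have dvdS : (n %| j.+1)%N = (j == n.-1)%N.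
  apply/idP/eqP => [/dvdn_leq|->]; last by rewrite prednK// ltnW.
  by move=> /(_ isT) nj; apply/eqP; rewrite -eqSS prednK ?(ltnW n_ge2)// eqn_leq j_lt_n.
have dvd1 : (n %| j + n.-1)%N = (j == 1%N).
  case: j j_lt_n {iso free dvd0 dvdS} => [|j] jn.
    by rewrite add0n gtnNdvd ?ltn_predL ?(ltnW n_ge2)// -ltnS prednK ?(ltnW n_ge2).
  rewrite addSnnS prednK ?(ltnW n_ge2)// dvdn_addl// eqSS.
  by case: j jn => [|j] jn; rewrite ?dvdn0 ?gtnNdvd// ltnW.
rewrite dvd0 dvdS dvd1 subn1 /= => tight; split=> [n2|n3].
  (* For [n = 2] the last two conditions coincide, and [j = 1] is counted twice. *)
  have nE : n.-1 = 1%N by rewrite n2.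
  by rewrite nE in tight; split=> jE; rewrite jE /= ?mul1n in tight.
(* For [n >= 3] the values 0, 1 and [n - 1] are distinct, so at most one term of [m] survives. *)
have nE k : (k < 2)%N -> (k == n.-1) = false.
  by move=> k2; rewrite ltn_eqF// (leq_trans k2)// -ltnS prednK// ltnW.
split; last split.
- by move=> jE; rewrite jE nE//= mul1n in tight.
- case=> jE; rewrite jE in tight; first by rewrite nE in tight.
  by rewrite eqxx ![n.-1 == _]eq_sym !nE in tight.
- by move=> [/eqP/negPf j0 [/eqP/negPf j1 /eqP/negPf jn]]; rewrite j0 j1 jn in tight.
Qed.
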